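(* Let $q$ be a prime power and let $L$ be a line of $\mathrm{PG}(5,q)$ in the $K$-orbit $o_{14,1}$. Then the hyperplane-orbit distribution $OD_4(L)$ is $\left[4,\,\frac{q^2-1}{2}+2q-1,\,\frac{q^2-1}{2}+q-1,\,q^3-2q\right]$ if $q$ is odd, and $\left[1,\,\frac{q^2}{2}+2q,\,\frac{q^2}{2}+q,\,q^3-2q\right]$ if $q$ is even.
   Context: A point $(y_0,\dots,y_5)$ of $\mathrm{PG}(5,q)$ is identified with the nonzero symmetric matrix $\begin{bmatrix} y_0&y_1&y_2\\ y_1&y_3&y_4\\ y_2&y_4&y_5\end{bmatrix}$ up to scalar. $K\cong\mathrm{PGL}(3,q)$ acts by $M\mapsto AMA^T$, $A\in\mathrm{GL}(3,q)$. The orbit $o_{14,1}$ is the $K$-orbit of the line $\left\{\begin{bmatrix}x&0&0\\0&-(x+y)&0\\0&0&y\end{bmatrix}:(x,y)\in\mathrm{PG}(1,q)\right\}$. Hyperplanes correspond to conics of $\mathrm{PG}(2,q)$ (nonzero quadratic forms up to scalar): $\sum_{0\le i\le j\le2}a_{ij}X_iX_j$ corresponds to $a_{00}Y_0+a_{01}Y_1+a_{02}Y_2+a_{11}Y_3+a_{12}Y_4+a_{22}Y_5=0$. $\mathcal H_1,\mathcal H_{2,r},\mathcal H_{2,i},\mathcal H_3$ are the sets of hyperplanes corresponding respectively to double lines (scalar multiples of squares of linear forms), pairs of distinct real lines (products of two non-proportional linear forms over $\mathbb F_q$), pairs of conjugate imaginary lines (scalar multiples of products of two non-proportional linear forms conjugate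 over $\mathbb F_{q^2}$), and non-singular conics (those with $4a_{00}a_{11}a_{22}+a_{01}a_{02}a_{12}-a_{00}a_{12}^2-a_{11}a_{02}^2-a_{22}a_{01}^2\ne0$). $OD_4(L)=[h_1,h_{2,r},h_{2,i},h_3]$ lists the numbers of hyperplanes in $\mathcal H_1,\mathcal H_{2,r},\mathcal H_{2,i},\mathcal H_3$ containing $L$. *)

(* Defs.v *)
From HB Require Import structures.
From mathcomp Require Import all_boot all_order all_algebra.
From mathcomp Require Import mpoly.

Set Implicit Arguments.
Unset Strict Implicit.
Unset Printing Implicit Defensive.

Import GRing.Theory.
Local Open Scope ring_scope.

(* The point (y_0,...,y_5) of PG(5,q) is the class, up to nonzero scalars, of
   the symmetric matrix M with y_0 = M 0 0, y_1 = M 0 1, y_2 = M 0 2,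
   y_3 = M 1 1, y_4 = M 1 2, y_5 = M 2 2. Lines and hyperplanes are sets of
   points. *)
Definition ppoint (F : finFieldType) (M : 'M[F]_3) : {set 'M[F]_3} :=
  [set c *: M | c : F & c != 0].

Definition PG5 (F : finFieldType) : {set {set 'M[F]_3}} :=
  [set ppoint M | M : 'M[F]_3 & (M^T == M) && (M != 0)].

Definition Kact (F : finFieldType) (A : 'M[F]_3) (P : {set 'M[F]_3}) :
    {set 'M[F]_3} :=
  [set A *m M *m A^T | M in P].

Definition line_14_1 (F : finFieldType) : {set {set 'M[F]_3}} :=
  [set ppoint (diag_mx (\row_(i < 3) [:: xy.1; - (xy.1 + xy.2); xy.2]`_i))
     | xy : F * F & xy != (0, 0)].

Definition o_14_1 (F : finFieldType) : {set {set {set 'M[F]_3}}} :=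
  [set [set Kact A P | P in line_14_1 F] | A : 'M[F]_3 & A \in unitmx].

(* A ternary quadratic form is given by its coefficients a i j with i <= j; the
   entries of a below the diagonal are never used. *)
Definition qform (F : finFieldType) (a : 'M[F]_3) : {mpoly F[3]} :=
  \sum_(i < 3) \sum_(j < 3 | (i <= j)%N) a i j *: ('X_i * 'X_j).

Definition linform (F : finFieldType) (u : 'rV[F]_3) : {mpoly F[3]} :=
  \sum_(i < 3) u 0 i *: 'X_i.

Definition hyperplane (F : finFieldType) (a : 'M[F]_3) : {set {set 'M[F]_3}} :=
  [set P in PG5 F | [forall M in P,
     \sum_(i < 3) \sum_(j < 3 | (i <= j)%N) a i j * M i j == 0]].

Definition nonproportional (F : finFieldType) (u v : 'rV[F]_3) : bool :=
  ~~ (u <= v)%MS && ~~ (v <= u)%MS.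

Definition double_line (F : finFieldType) (a : 'M[F]_3) : bool :=
  [exists c : F, exists u : 'rV[F]_3, qform a == c *: linform u ^+ 2].

Definition real_pair (F : finFieldType) (a : 'M[F]_3) : bool :=
  [exists u : 'rV[F]_3, exists v : 'rV[F]_3,
     nonproportional u v && (qform a == linform u * linform v)].

(* With q = #|F|, the conjugation of GF(q^2) over GF(q) is x |-> x ^+ q. *)
Definition conj_row (E : finFieldType) (q : nat) (u : 'rV[E]_3) : 'rV[E]_3 :=
  map_mx (fun x => x ^+ q) u.

(* E stands for GF(q^2): this is only meaningful when #|E| = #|F| ^ 2. *)
Definition imaginary_pair (F E : finFieldType) (iota : {rmorphism F -> E})
    (a : 'M[F]_3) : bool :=
  [exists c : F, exists u : 'rV[E]_3,
     nonproportional u (conj_row #|F| u) &&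
     (map_mpoly iota (qform a) ==
        iota c *: (linform u * linform (conj_row #|F| u)))].

Definition nonsingular_conic (F : finFieldType) (a : 'M[F]_3) : bool :=
  4%:R * a 0 0 * a 1 1 * a 2 2 + a 0 1 * a 0 2 * a 1 2
    - a 0 0 * a 1 2 ^+ 2 - a 1 1 * a 0 2 ^+ 2 - a 2 2 * a 0 1 ^+ 2 != 0.

Definition hyperplanes_of (F : finFieldType) (P : pred 'M[F]_3) :
    {set {set {set 'M[F]_3}}} :=
  [set hyperplane a | a : 'M[F]_3 & (qform a != 0) && P a].

Definition count_through (F : finFieldType) (L : {set {set 'M[F]_3}})
    (HH : {set {set {set 'M[F]_3}}}) : nat :=
  #|[set H in HH | L \subset H]|.

Definition OD4 (F E : finFieldType) (iota : {rmorphism F -> E})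
    (L : {set {set 'M[F]_3}}) : seq nat :=
  [:: count_through L (hyperplanes_of (@double_line F));
      count_through L (hyperplanes_of (@real_pair F));
      count_through L (hyperplanes_of (imaginary_pair iota));
      count_through L (hyperplanes_of (@nonsingular_conic F))].

(* Main.v *)
(* A hyperplane contains the standard line iff its quadratic form has equal
   diagonal coefficients, i.e. is x(X^2+Y^2+Z^2) + bXY + cXZ + dYZ, and the type
   of a form is invariant under GL(3,q), so only these forms have to be counted.
   If x = 0, the form is singular iff bcd = 0, and then it is a product of two
   distinct real linear forms. If x = 1 and the form is l * m up to a scalar,
   with l = X + sY + tZ, then m = X + Y/s + Z/t and
   (b, c, d) = (s + 1/s, t + 1/t, s/t + t/s); this map identifies exactly (s, t)
   with (1/s, 1/t). Double lines come from s^2 = t^2 = 1, real pairs from the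
   other (s, t) with s, t in GF(q)^*, and imaginary pairs from the other (s, t)
   with s, t in the group of elements of norm 1 of GF(q^2), which has q + 1
   elements. The non-singular forms are counted by projecting the cubic surface
   bcd - b^2 - c^2 - d^2 + 4 = 0 from its double point (2, 2, 2). *)
Require Import Defs.
From HB Require Import structures.
From mathcomp Require Import all_boot all_order all_algebra cyclic finfield.
From mathcomp Require Import mpoly ring zify.

Set Implicit Arguments.
Unset Strict Implicit.
Unset Printing Implicit Defensive.

Import GRing.Theory.
Local Open Scope ring_scope.

(** * Ternary quadratic forms as matrices *)

Lemma big_ord3 (V : nmodType) (f : 'I_3 -> V) :
  \sum_(i < 3) f i = f 0 + f 1 + f 2.
Proof.
rewrite 3!big_ord_recr big_ord0 /=. rewrite add0r.
by congr (f _ + f _ + f _); apply: val_inj.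
Qed.

Lemma big_ord3_le (V : nmodType) (f : 'I_3 -> 'I_3 -> V) :
  \sum_(i < 3) \sum_(j < 3 | (i <= j)%N) f i j =
  f 0 0 + f 0 1 + f 0 2 + f 1 1 + f 1 2 + f 2 2.
Proof.
under eq_bigr do rewrite big_mkcond.
by rewrite !big_ord3 /= !add0r !addrA.
Qed.

Lemma ord3P (P : 'I_3 -> Prop) : P 0 -> P 1 -> P 2 -> forall i, P i.
Proof.
move=> P0 P1 P2 [[|[|[|//]]] lt_i].
- by have -> : Ordinal lt_i = 0 by apply: val_inj.
- by have -> : Ordinal lt_i = 1 by apply: val_inj.
- by have -> : Ordinal lt_i = 2 by apply: val_inj.
Qed.

(** Clearing the entries that a form ignores gives a canonical coefficient matrix, so that equality
    of forms becomes equality of matrices. *)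
Definition utri (R : pzRingType) (a : 'M[R]_3) : 'M[R]_3 :=
  \matrix_(i, j) if (i <= j)%N then a i j else 0.

(* The upper triangular matrix with the same quadratic form [x B x^T] as [B]. *)
Definition fold (R : pzRingType) (B : 'M[R]_3) : 'M[R]_3 :=
  \matrix_(i, j) if i == j then B i i else if (i < j)%N then B i j + B j i else 0.

Definition qval (R : pzRingType) (B : 'M[R]_3) (x : 'rV[R]_3) : R :=
  (x *m B *m x^T) 0 0.

Lemma fold_utri (R : pzRingType) (a : 'M[R]_3) : fold (utri a) = utri a.
Proof.
apply/matrixP; elim/ord3P; elim/ord3P; rewrite !mxE //= ?addr0 //.
Qed.

Lemma utri_fold (R : pzRingType) (B : 'M[R]_3) : utri (fold B) = fold B.
Proof. by apply/matrixP; elim/ord3P; elim/ord3P; rewrite !mxE. Qed.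

Lemma qvalE (R : comPzRingType) (B : 'M[R]_3) (x : 'rV[R]_3) :
  qval B x = \sum_(i < 3) \sum_(j < 3 | (i <= j)%N) fold B i j * (x 0 i * x 0 j).
Proof.
rewrite big_ord3_le /qval !mxE big_ord3 !mxE !big_ord3 /=. ring.
Qed.

(** The values at [e_i] and [e_i + e_j] already recover every coefficient; no division by 2 is
    involved. *)
Lemma fold_qval (R : comPzRingType) (B B' : 'M[R]_3) :
  qval B =1 qval B' <-> fold B = fold B'.
Proof.
split=> [eqB | eqB x]; last by rewrite !qvalE eqB.
have qvalD (C : 'M[R]_3) i j : qval C (delta_mx 0 i + delta_mx 0 j) =
    C i i + C j j + (C i j + C j i).
  rewrite /qval linearD /= !(mulmxDl, mulmxDr) -!rowE !trmx_delta -!colE !mxE.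
  ring.
have qval1 (C : 'M[R]_3) i : qval C (delta_mx 0 i) = C i i.
  by rewrite /qval -rowE trmx_delta -colE !mxE.
have eqd i : B i i = B' i i by rewrite -!qval1 eqB.
apply/matrixP=> i j; rewrite !mxE; case: eqP => // _; case: ifP => // _.
have := eqB (delta_mx 0 i + delta_mx 0 j).
by rewrite !qvalD !eqd => /addrI.
Qed.

Lemma qval_congr (R : comPzRingType) (A B : 'M[R]_3) x :
  qval (A^T *m B *m A) x = qval B (x *m A^T).
Proof. by rewrite /qval trmx_mul trmxK !mulmxA. Qed.

Lemma fold_congr (R : comPzRingType) (A B B' : 'M[R]_3) :
  fold B = fold B' -> fold (A^T *m B *m A) = fold (A^T *m B' *m A).
Proof.
by move/fold_qval=> eqB; apply/fold_qval=> x; rewrite !qval_congr eqB.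
Qed.

(** Distinct polynomials may agree as functions on a small field, but quadratic forms do not: by
    [fold_qval] their values determine the coefficients. *)
Lemma qform_inj (F : finFieldType) (a b : 'M[F]_3) :
  qform a = qform b -> utri a = utri b.
Proof.
move=> eq_ab; rewrite -[LHS]fold_utri -[RHS]fold_utri; apply/fold_qval => x.
have := congr1 (meval (fun i => x 0 i)) eq_ab.
have E c : (qform c).@[fun i => x 0 i] = qval (utri c) x.
  rewrite qvalE fold_utri /qform !big_ord3_le !mxE /=.
  by rewrite !(mevalD, mevalZ, mevalM, mevalXU).
by rewrite !E.
Qed.

Lemma qform_utri (F : finFieldType) (a : 'M[F]_3) : qform (utri a) = qform a.
Proof.
by rewrite /qform; apply: eq_bigr => i _; apply: eq_bigr => j le_ij; rewrite mxE le_ij.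
Qed.

Lemma qform_eq (F : finFieldType) (a b : 'M[F]_3) :
  (qform a == qform b) = (utri a == utri b).
Proof.
apply/eqP/eqP; first exact: qform_inj.
by move=> eq_ab; rewrite -qform_utri eq_ab qform_utri.
Qed.

Lemma qform0 (F : finFieldType) : qform (0 : 'M[F]_3) = 0.
Proof. by rewrite /qform !big_ord3_le !mxE !scale0r !addr0. Qed.

Lemma utri0 (R : pzRingType) : utri (0 : 'M[R]_3) = 0.
Proof. by apply/matrixP=> i j; rewrite !mxE if_same. Qed.

Lemma qform_eq0 (F : finFieldType) (a : 'M[F]_3) : (qform a == 0) = (utri a == 0).
Proof. by rewrite -qform0 qform_eq utri0. Qed.


(** This turns factorization of a form into a matrix identity with a matrix [u^T *m v] of rank at
    most one. *)
Lemma linform_mul (F : finFieldType) (u v : 'rV[F]_3) :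
  linform u * linform v = qform (fold (u^T *m v)).
Proof.
rewrite /qform /linform !big_ord3_le !big_ord3 !mxE !big_ord1 !mxE /= -!mul_mpolyC.
rewrite !mpolyCD !mpolyCM. ring.
Qed.

Lemma qform_map (F E : finFieldType) (iota : {rmorphism F -> E}) (a : 'M[F]_3) :
  map_mpoly iota (qform a) = qform (map_mx iota a).
Proof.
rewrite /qform !big_ord3_le !mxE !rmorphD /= !map_mpolyZ.
by rewrite !rmorphM /= !map_mpolyX.
Qed.

(** In odd characteristic this is four times the determinant of the symmetric matrix of the form;
    the expression without denominators also serves characteristic 2. *)
Definition disc (R : pzRingType) (a : 'M[R]_3) : R :=
  4%:R * a 0 0 * a 1 1 * a 2 2 + a 0 1 * a 0 2 * a 1 2
    - a 0 0 * a 1 2 ^+ 2 - a 1 1 * a 0 2 ^+ 2 - a 2 2 * a 0 1 ^+ 2.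

Lemma disc_congr (R : comPzRingType) (A : 'M[R]_3) : exists d, forall a : 'M[R]_3,
  disc (fold (A^T *m utri a *m A)) = d ^+ 2 * disc a.
Proof.
(* The witness is the determinant of [A], expanded so that [ring] can verify the identity. *)
exists (A 0 0 * (A 1 1 * A 2 2 - A 1 2 * A 2 1)
  - A 0 1 * (A 1 0 * A 2 2 - A 1 2 * A 2 0)
  + A 0 2 * (A 1 0 * A 2 1 - A 1 1 * A 2 0)) => a.
rewrite /disc !mxE /= !big_ord3 !mxE !big_ord3 !mxE /=. ring.
Qed.

(** * Hyperplanes through a line of the orbit *)

Definition pairing (R : pzRingType) (a M : 'M[R]_3) : R :=
  \sum_(i < 3) \sum_(j < 3 | (i <= j)%N) a i j * M i j.

(** Incidence written as a trace can use the cyclicity of the trace, which yields [pairing_pull]. *)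
Lemma pairing_fold (R : comPzRingType) (B M : 'M[R]_3) :
  M^T = M -> pairing (fold B) M = \tr (B *m M).
Proof.
move=> symM; rewrite /pairing big_ord3_le /mxtrace big_ord3 !mxE !big_ord3 /=.
have symE i j : M i j = M j i by rewrite -{1}symM mxE.
rewrite (symE 1 0) (symE 2 0) (symE 2 1). ring.
Qed.

Lemma pairing_utri (R : pzRingType) (a M : 'M[R]_3) :
  pairing (utri a) M = pairing a M.
Proof. by rewrite /pairing !big_ord3_le !mxE. Qed.

(* The coefficients of the form [a], read on upper triangular matrices, after
   the substitution [x |-> x A^T]. *)
Definition pull (R : pzRingType) (A a : 'M[R]_3) : 'M[R]_3 :=
  fold (A^T *m utri a *m A).

Lemma fold_fold (R : pzRingType) (B : 'M[R]_3) : fold (fold B) = fold B.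
Proof. by rewrite -[X in fold X = _]utri_fold fold_utri utri_fold. Qed.

Lemma pull_comp (R : comPzRingType) (A B a : 'M[R]_3) :
  pull A (pull B a) = pull (B *m A) a.
Proof.
rewrite /pull utri_fold trmx_mul !mulmxA.
rewrite (@fold_congr _ _ _ (B^T *m utri a *m B)) ?fold_fold //.
by rewrite !mulmxA.
Qed.

Lemma pull1 (R : comPzRingType) (a : 'M[R]_3) : pull 1%:M a = utri a.
Proof. by rewrite /pull trmx1 mul1mx mulmx1 fold_utri. Qed.

Lemma utri_pull (R : pzRingType) (A a : 'M[R]_3) : utri (pull A a) = pull A a.
Proof. exact: utri_fold. Qed.

Lemma pullK (R : comUnitRingType) (A a : 'M[R]_3) : A \in unitmx ->
  pull (invmx A) (pull A a) = utri a.
Proof. by move=> uA; rewrite pull_comp mulmxV // pull1. Qed.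

Lemma pullKV (R : comUnitRingType) (A a : 'M[R]_3) : A \in unitmx ->
  pull A (pull (invmx A) a) = utri a.
Proof. by move=> uA; rewrite pull_comp mulVmx // pull1. Qed.

Lemma pull0 (R : pzRingType) (A : 'M[R]_3) : pull A 0 = 0.
Proof.
by rewrite /pull utri0 mulmx0 mul0mx; apply/matrixP=> i j; rewrite !mxE addr0 !if_same.
Qed.

Lemma utriZ (R : pzRingType) c (a : 'M[R]_3) : utri (c *: a) = c *: utri a.
Proof. by apply/matrixP=> i j; rewrite !mxE; case: ifP; rewrite ?mulr0. Qed.

Lemma foldZ (R : pzRingType) c (B : 'M[R]_3) : fold (c *: B) = c *: fold B.
Proof.
apply/matrixP=> i j; rewrite !mxE; case: ifP => // _.
by case: ifP => _; rewrite ?mulr0 ?mulrDr.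
Qed.

Lemma pullZ (R : comPzRingType) (A a : 'M[R]_3) c : pull A (c *: a) = c *: pull A a.
Proof. by rewrite /pull utriZ -scalemxAr -scalemxAl foldZ. Qed.

Lemma sym_congr (R : comPzRingType) (A M : 'M[R]_3) :
  M^T = M -> (A *m M *m A^T)^T = A *m M *m A^T.
Proof. by move=> symM; rewrite !trmx_mul trmxK symM mulmxA. Qed.

(** Substitution in forms is adjoint to the action on points. Questions about a line of the orbit
    thus reduce to the standard line. *)
Lemma pairing_pull (R : comPzRingType) (A a M : 'M[R]_3) :
  M^T = M -> pairing (pull A a) M = pairing a (A *m M *m A^T).
Proof.
move=> symM; rewrite -(pairing_utri a) -(fold_utri a) !pairing_fold ?sym_congr //.
by rewrite -!mulmxA mxtrace_mulC !mulmxA.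
Qed.

Lemma pairingZr (R : comPzRingType) (a M : 'M[R]_3) c :
  pairing a (c *: M) = c * pairing a M.
Proof. rewrite /pairing !big_ord3_le !mxE. ring. Qed.

Lemma pairingZl (R : comPzRingType) (a M : 'M[R]_3) c :
  pairing (c *: a) M = c * pairing a M.
Proof. rewrite /pairing !big_ord3_le !mxE. ring. Qed.

(** For suitable [x] and [y] the value is a 2 x 2 minor of two coefficient vectors, so these test
    points detect proportionality. *)
Lemma pairing_delta (R : comPzRingType) (i0 j0 i j : 'I_3) (x y : R) :
  (i0 <= j0)%N -> (i <= j)%N ->
  exists2 M : 'M[R]_3, M^T = M &
    forall a : 'M[R]_3, pairing a M = a i0 j0 * x - a i j * y.
Proof.
(* The disjunction, instead of a sum of two elementary matrices, keeps the entry equal to 1 when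
   [i = j]. *)
pose S (i j : 'I_3) : 'M[R]_3 :=
  \matrix_(k, l) (((k == i) && (l == j)) || ((k == j) && (l == i)))%:R.
have SE (i1 j1 : 'I_3) : (i1 <= j1)%N ->
    forall a : 'M[R]_3, pairing a (S i1 j1) = a i1 j1.
  move=> le1 a; rewrite /pairing big_ord3_le.
  move: i1 j1 le1; elim/ord3P; elim/ord3P => //= _; rewrite !mxE /= ?eqxx; ring.
move=> le0 le1; exists (x *: S i0 j0 - y *: S i j).
  have symS i1 j1 : (S i1 j1)^T = S i1 j1.
    apply/matrixP=> k l; rewrite !mxE orbC.
    congr (nat_of_bool (_ || _))%:R; exact: andbC.
  by rewrite linearB /= !linearZ /= !symS.
move=> a.
have pD M N : pairing a (M + N) = pairing a M + pairing a N.
  rewrite /pairing !big_ord3_le !mxE; ring.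
by rewrite pD -scaleNr !pairingZr !SE // mulNr mulrC [y * _]mulrC.
Qed.

Section Points.
Variable F : finFieldType.
Implicit Types (a M A : 'M[F]_3) (c : F).

Lemma mem_ppoint M : M \in ppoint M.
Proof. by apply/imsetP; exists 1; rewrite ?scale1r // inE oner_eq0. Qed.

Lemma mem_hyperplane a M : M^T = M -> M != 0 ->
  (ppoint M \in hyperplane a) = (pairing a M == 0).
Proof.
move=> symM nzM; rewrite inE; apply/andP/eqP => [[_ /forall_inP aH] | aM].
  exact/eqP/aH/mem_ppoint.
split; first by apply/imsetP; exists M; rewrite // inE symM eqxx.
apply/forall_inP => _ /imsetP[c _ ->].
by have := pairingZr a M c; rewrite aM mulr0 /pairing => ->.
Qed.

Lemma eq_hyperplane a b : (forall M, pairing a M == 0 = (pairing b M == 0)) ->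
  hyperplane a = hyperplane b.
Proof.
move=> eq_ab; apply/setP=> P; rewrite !inE; congr (_ && _).
by apply: eq_forallb => M; congr (_ ==> _); apply: eq_ab.
Qed.

Lemma hyperplane_utri a : hyperplane (utri a) = hyperplane a.
Proof. by apply: eq_hyperplane => M; rewrite pairing_utri. Qed.

Lemma hyperplaneZ a c : c != 0 -> hyperplane (c *: a) = hyperplane a.
Proof.
by move=> nz_c; apply: eq_hyperplane => M; rewrite pairingZl mulf_eq0 (negPf nz_c).
Qed.

(** Fix a nonzero coefficient [a i0 j0]. For each [(i, j)], the test point with [x = a i j] and
    [y = a i0 j0] lies on the hyperplane of [a], hence on that of [b], which makes the corresponding
    minor vanish. *)
Lemma hyperplane_inj a b : utri a = a -> utri b = b -> a != 0 -> b != 0 ->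
  hyperplane a = hyperplane b -> exists2 c, c != 0 & b = c *: a.
Proof.
move=> ua ub nza nzb eq_ab.
have incl M : M^T = M -> pairing a M = 0 -> pairing b M = 0.
  move=> symM /eqP aM; have [-> | nzM] := eqVneq M 0.
    by rewrite -(scale0r 0) pairingZr mul0r.
  by apply/eqP; rewrite -mem_hyperplane // -eq_ab mem_hyperplane.
have lower (d : 'M[F]_3) (i j : 'I_3) : utri d = d -> ~~ (i <= j)%N -> d i j = 0.
  by move=> <- /negPf lt_ji; rewrite mxE lt_ji.
have [[i0 j0] /= nz0] : exists ij, a ij.1 ij.2 != 0.
  apply/existsP; apply: contraNT nza => /existsPn a0; apply/eqP/matrixP=> i j.
  by have := a0 (i, j); rewrite negbK mxE => /eqP.
have le0 : (i0 <= j0)%N by apply: contraNT nz0 => /lower->.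
have bE : b = (b i0 j0 / a i0 j0) *: a.
  apply/matrixP=> i j; rewrite mxE; have [le1 | lt_ji] := boolP (i <= j)%N; last first.
    by rewrite (lower b i j) // (lower a i j) // mulr0.
  have [M symM ME] := pairing_delta (a i j) (a i0 j0) le0 le1.
  have := incl M symM; rewrite !ME mulrC subrr => /(_ erefl)/eqP.
  by rewrite subr_eq0 => /eqP; rewrite mulrAC => ->; rewrite mulfK.
exists (b i0 j0 / a i0 j0) => //; apply: contraNneq nzb => c0.
by rewrite bE c0 scale0r.
Qed.

Lemma Kact_ppoint A M : Kact A (ppoint M) = ppoint (A *m M *m A^T).
Proof.
rewrite /Kact /ppoint -imset_comp; apply: eq_in_imset => c _ /=.
by rewrite -scalemxAr -scalemxAl.
Qed.

Definition equidiag (R : eqType) (b : 'M[R]_3) : bool :=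
  (b 0 0 == b 1 1) && (b 2 2 == b 1 1).

(** After the adjunction, a form [b] pairs with the point [(x, y)] of the standard line to
    [(b00 - b11) x + (b22 - b11) y], which vanishes identically exactly when the diagonal is
    constant. *)
Lemma line_sub_hyperplane A a : A \in unitmx ->
  ([set Kact A P | P in line_14_1 F] \subset hyperplane a) = equidiag (pull A a).
Proof.
move=> uA.
pose D (p : F * F) : 'M[F]_3 :=
  diag_mx (\row_(i < 3) [:: p.1; - (p.1 + p.2); p.2]`_i).
have symD p : (D p)^T = D p by rewrite tr_diag_mx.
have D_nz p : p != (0, 0) -> D p != 0.
  apply: contraNneq => D0; have := congr1 (fun M : 'M_3 => (M 0 0, M 2 2)) D0.
  by rewrite !mxE /= !mulr1n; case: p {D0} => x y /= [-> ->].
have AD_nz p : p != (0, 0) -> A *m D p *m A^T != 0.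
  move/D_nz; apply: contraNneq => AD0; apply/eqP.
  have: invmx A *m (A *m D p *m A^T) *m invmx A^T = 0 by rewrite AD0 mulmx0 mul0mx.
  by rewrite !mulmxA mulVmx // mul1mx mulmxK // unitmx_tr.
have pD b p : pairing b (D p) = b 0 0 * p.1 - b 1 1 * (p.1 + p.2) + b 2 2 * p.2.
  rewrite /pairing big_ord3_le !mxE /=; ring.
transitivity [forall p, (p != (0, 0)) ==> (pairing (pull A a) (D p) == 0)].
  apply/subsetP/forall_inP => [sub p nzp | sub _ /imsetP[_ /imsetP[p nzp ->] ->]].
    rewrite pairing_pull // -mem_hyperplane ?sym_congr ?AD_nz //; apply: sub.
    by rewrite -Kact_ppoint; apply/imset_f/imsetP; exists p; rewrite ?inE.
  rewrite inE in nzp.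
  by rewrite -/(D p) Kact_ppoint mem_hyperplane ?sym_congr ?AD_nz //
    -(pairing_pull A a (symD p)) sub.
apply/forall_inP/andP => [sub | [/eqP e0 /eqP e2] p _]; last first.
  by rewrite pD e0 e2; apply/eqP; ring.
(* The two points [(1, 0)] and [(0, 1)] span the line and give the two equations separately. *)
have := sub (1, 0); have := sub (0, 1); rewrite !pD /=.
rewrite !xpair_eqE oner_eq0 eqxx /= => /(_ isT) s1 /(_ isT) s2.
split; rewrite -subr_eq0; first by move: s2; apply: etrans; congr (_ == 0); ring.
by move: s1; apply: etrans; congr (_ == 0); ring.
Qed.

End Points.

(** * From hyperplanes to coefficient vectors *)

Lemma card_nonzero (F : finFieldType) : #|[set x : F | x != 0]| = #|F|.-1.
Proof. by rewrite -(cardC1 (0 : F)); apply: eq_card => c; rewrite !inE. Qed.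

Lemma card_imset_fiber (aT rT : finType) (f : aT -> rT) (A : {set aT}) k :
  (forall x, x \in A -> #|[set y in A | f y == f x]| = k) ->
  (#|f @: A| * k)%N = #|A|.
Proof.
move=> fib; rewrite -[RHS]sum1_card (partition_big_imset f) /= -sum_nat_const.
apply: eq_bigr => _ /imsetP[x xA ->]; rewrite -(fib _ xA) -sum1_card.
by apply: eq_bigl => y; rewrite inE.
Qed.

Section Counting.
Variable F : finFieldType.
Implicit Types (a b A : 'M[F]_3) (c : F).

(** The equations of one hyperplane are the [#|F|.-1] nonzero multiples of any of them. When [L] is
    the image of the standard line under [A], [pull A] maps the equations of hyperplanes through [L]
    bijectively to those through the standard line, and [P] is preserved. *)
Lemma count_through_vectors (P : pred 'M[F]_3) (L : {set {set 'M[F]_3}}) :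
    (forall A a, A \in unitmx -> P (pull A a) = P a) ->
    (forall c a, c != 0 -> P (c *: a) = P a) -> L \in o_14_1 F ->
  (count_through L (hyperplanes_of P) * #|F|.-1)%N =
    #|[set a | [&& utri a == a, a != 0, P a & equidiag a]]|.
Proof.
move=> Ppull PZ /imsetP[A]; rewrite inE => uA ->{L}.
have Pu a : P (utri a) = P a by rewrite -pull1 Ppull ?unitmx1.
pose V := [set a | [&& utri a == a, a != 0, P a & equidiag (pull A a)]].
have ->: count_through [set Kact A P | P in line_14_1 F] (hyperplanes_of P) =
    #|hyperplane (F:=F) @: V|.
  congr #|pred_of_set _|; apply/setP => H; rewrite inE.
  apply/andP/imsetP => [[/imsetP[a]] | [a]]; rewrite inE.
    rewrite qform_eq0 => /andP[nza Pa] -> sub.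
    exists (utri a); last by rewrite hyperplane_utri.
    rewrite inE -[X in utri X == _]fold_utri utri_fold fold_utri eqxx nza Pu Pa.
    by rewrite -line_sub_hyperplane // hyperplane_utri.
  case/and4P=> /eqP ua nza Pa Da ->; rewrite line_sub_hyperplane //; split=> //.
  by apply/imsetP; exists a; rewrite // inE qform_eq0 ua nza Pa.
rewrite (@card_imset_fiber _ _ _ _ #|F|.-1) => [|a].
  rewrite -[LHS](@card_in_imset _ _ (pull A)) => [|a b]; last first.
    rewrite !inE => /and4P[/eqP ua _ _ _] /and4P[/eqP ub _ _ _].
    by move/(congr1 (pull (invmx A))); rewrite !pullK // ua ub.
  congr #|pred_of_set _|; apply/setP=> b; rewrite inE.
  apply/imsetP/and4P => [[a] | [/eqP ub nzb Pb Db]].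
    rewrite inE => /and4P[/eqP ua nza Pa Da] ->.
    rewrite utri_pull Ppull //; split=> //.
    apply: contraNneq nza => pa0; have := pullK a uA; rewrite ua => <-.
    by rewrite pa0 pull0.
  exists (pull (invmx A) b); last by rewrite pullKV.
  rewrite inE utri_pull eqxx Ppull ?unitmx_inv // Pb pullKV // ub Db !andbT /=.
  by apply: contraNneq nzb => pb0; have := pullKV b uA; rewrite pb0 pull0 ub => <-.
rewrite inE => /and4P[/eqP ua nza Pa Da].
rewrite -card_nonzero.
have <- : #|[set c *: a | c in [set c : F | c != 0]]| = #|[set c : F | c != 0]|.
  apply: card_in_imset => c c' _ _ /eqP.
  by rewrite -subr_eq0 -scalerBl scaler_eq0 (negPf nza) orbF subr_eq0 => /eqP.
congr #|pred_of_set _|; apply/setP=> b; rewrite !inE.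
apply/andP/imsetP => [[/and4P[/eqP ub nzb _ _] /eqP/esym eqH] | [c]].
  by have [c nz_c ->] := hyperplane_inj ua ub nza nzb eqH; exists c; rewrite // inE.
rewrite inE => nz_c ->; rewrite hyperplaneZ // eqxx PZ // Pa scaler_eq0 (negPf nz_c) nza.

case/andP: Da => /eqP e0 /eqP e2; split=> //.
have ZE i j : (c *: pull A a) i j = c * pull A a i j by rewrite mxE.
by rewrite utriZ ua pullZ /equidiag !ZE e0 e2 !eqxx.
Qed.
End Counting.

(** * Forms with equal diagonal coefficients *)

Definition std_form (R : pzRingType) (x : R) (w : R * R * R) : 'M[R]_3 :=
  \matrix_(i, j) (nth [::] [:: [:: x; w.1.1; w.1.2]; [:: 0; x; w.2]; [:: 0; 0; x]] i)`_j.

(** For [p = (s, t)], these are the coefficients of [XY], [XZ] and [YZ] in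
    [(X + sY + tZ)(X + Y/s + Z/t)]. *)
Definition recip (K : fieldType) (p : K * K) : K * K * K :=
  (p.1 + p.1^-1, p.2 + p.2^-1, p.1 / p.2 + p.2 / p.1).

Lemma utri_std (R : pzRingType) (x : R) w : utri (std_form x w) = std_form x w.
Proof. by apply/matrixP; elim/ord3P; elim/ord3P; rewrite !mxE. Qed.

Lemma std_inj (R : pzRingType) (x y : R) w v :
  std_form x w = std_form y v -> x = y /\ w = v.
Proof.
move=> /matrixP eq_xy.
have := (eq_xy 0 0, eq_xy 0 1, eq_xy 0 2, eq_xy 1 2); rewrite !mxE /=.
by case: w v {eq_xy} => [[? ?] ?] [[? ?] ?] /= [[[-> ->] ->] ->].
Qed.

Lemma stdZ (R : pzRingType) (c x : R) w :
  c *: std_form x w = std_form (c * x) (c * w.1.1, c * w.1.2, c * w.2).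
Proof. by apply/matrixP; elim/ord3P; elim/ord3P; rewrite !mxE /= ?mulr0. Qed.

Lemma equidiag_std (R : pzRingType) (a : 'M[R]_3) : utri a = a -> equidiag a ->
  a = std_form (a 1 1) (a 0 1, a 0 2, a 1 2).
Proof.
move=> ua /andP[/eqP e0 /eqP e2]; apply/matrixP.
elim/ord3P; elim/ord3P; rewrite [RHS]mxE //=;
  by rewrite -ua mxE.
Qed.

Lemma std_equidiag (R : pzRingType) (x : R) w : equidiag (std_form x w).
Proof. by rewrite /equidiag !mxE /= !eqxx. Qed.

Lemma std0 (R : pzRingType) : std_form (0 : R) 0 = 0.
Proof. by apply/matrixP; elim/ord3P; elim/ord3P; rewrite !mxE. Qed.

(** The split is by the common diagonal coefficient: if it is nonzero, it can be scaled to 1 in a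
    unique way, which accounts for the factor [#|F|.-1]; if it is zero, the zero form has to be
    excluded. *)
Lemma card_std (F : finFieldType) (P : pred 'M[F]_3) :
    (forall c a, c != 0 -> P (c *: a) = P a) ->
  #|[set a | [&& utri a == a, a != 0, P a & equidiag a]]| =
    (#|F|.-1 * #|[set w | P (std_form 1%R w)]| +
     #|[set w : F * F * F | ((w != 0) && P (std_form 0 w))%R]|)%N.
Proof.
move=> PZ; rewrite -(cardsID [set a : 'M[F]_3 | a 1 1 != 0]); congr addn.
  rewrite -card_nonzero -cardsX.
  rewrite -[RHS](@card_in_imset _ _ (fun p => p.1 *: std_form 1 p.2)); last first.
    move=> [c w] [d v]; rewrite !inE /= => /andP[nzc _] /andP[nzd _].
    rewrite !stdZ !mulr1 => /std_inj[<- [/(mulfI nzc) e1 /(mulfI nzc) e2 /(mulfI nzc) e3]].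
    by case: w v e1 e2 e3 => [[? ?] ?] [[? ?] ?] /= -> -> ->.
  congr #|pred_of_set _|; apply/setP=> a; rewrite !inE.
  apply/idP/imsetP => [/andP[/and4P[/eqP ua nza Pa Da] nz1] | [[c w]]].
    have aE : a = a 1 1 *: std_form 1 (a 0 1 / a 1 1, a 0 2 / a 1 1, a 1 2 / a 1 1).
      by rewrite stdZ /= mulr1 ![a 1 1 * _]mulrC !divfK // -equidiag_std.
    exists (a 1 1, (a 0 1 / a 1 1, a 0 2 / a 1 1, a 1 2 / a 1 1)) => //.
      by rewrite // !inE nz1 /= -(PZ _ _ nz1) -aE.
  rewrite !inE /= => /andP[nzc Pw] ->; rewrite PZ // Pw utriZ utri_std eqxx.
  rewrite stdZ mulr1 std_equidiag mxE /= nzc !andbT.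
  by apply: contraNneq nzc => /matrixP/(_ 0 0); rewrite !mxE /= => ->.
rewrite -[RHS](@card_imset _ _ (std_form 0)) => [|w v /std_inj[] //].
congr #|pred_of_set _|; apply/setP=> a; rewrite !inE negbK.
apply/idP/imsetP => [/andP[/eqP a0 /and4P[/eqP ua nza Pa Da]] | [w]].
  have aE := equidiag_std ua Da; rewrite a0 in aE.
  exists (a 0 1, a 0 2, a 1 2); rewrite // inE -aE Pa andbT.
  by apply: contraNneq nza => w0; rewrite aE w0 std0.
rewrite inE => /andP[nzw Pw] ->; rewrite mxE /= eqxx utri_std eqxx Pw std_equidiag !andbT /=.
by apply: contraNneq nzw; rewrite -std0 => /std_inj[_ ->].
Qed.

(** * Fibres of the reciprocal parametrization *)

Section Reciprocal.
Variable K : finFieldType.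
Implicit Types (s t : K) (p : K * K) (u v : 'rV[K]_3).

(** Both [s] and its inverse are the roots of [X^2 - (s + 1/s) X + 1], and [t] is a root of the same
    polynomial. *)
Lemma add_inv_inj s t : s != 0 -> t != 0 -> s + s^-1 = t + t^-1 -> t = s \/ t = s^-1.
Proof.
move=> nzs nzt eq_st.
have /eqP : (t - s) * (t - s^-1) = 0.
  have -> : (t - s) * (t - s^-1) =
      t * (t - (s + s^-1) + s * s^-1 * t^-1) + s * s^-1 * (1 - t * t^-1) by ring.
  rewrite eq_st !mulfV // mul1r; ring: (mulfV nzt).
by rewrite mulf_eq0 !subr_eq0 => /orP[] /eqP ->; [left | right].
Qed.

(** This is the effect on [(s, t)] of exchanging the two linear factors. *)
Definition inv2 p : K * K := (p.1^-1, p.2^-1).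

Lemma sqr_eq1_inv s : s != 0 -> (s ^+ 2 == 1) = (s^-1 == s).
Proof.
by move=> nz; rewrite -[RHS](inj_eq (mulfI nz)) mulfV // eq_sym expr2.
Qed.

Lemma recip_inv2 p : recip (inv2 p) = recip p.
Proof.
rewrite /recip /inv2 /= !invrK; congr (_, _, _); ring.
Qed.

(** The first two coordinates determine [s] and [t] up to separate inversions. The third one rules
    out inverting only one of them, unless [s] or [t] is its own inverse, and then the mixed choice
    is one of the two allowed ones. *)
Lemma recip_inj p p' : p.1 != 0 -> p.2 != 0 -> p'.1 != 0 -> p'.2 != 0 ->
  recip p = recip p' -> p' = p \/ p' = inv2 p.
Proof.
case: p p' => [s t] [s' t'] /= nzs nzt nzs' nzt' [/add_inv_inj e1 /add_inv_inj e2].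
have swap (x y : K) : x != 0 -> y != 0 -> x / y + y / x = x / y^-1 + y^-1 / x ->
    x^-1 = x \/ y^-1 = y.
  move=> nzx nzy exy.
  (* The two candidate values [xy + 1/(xy)] and [x/y + y/x] of the third coordinate differ by
     [(x^2 - 1)(y^2 - 1) / (xy)]. *)
  have /eqP : (x ^+ 2 - 1) * (y ^+ 2 - 1) = 0.
    have -> : (x ^+ 2 - 1) * (y ^+ 2 - 1) =
        (x * y) * ((x / y^-1 + y^-1 / x) - (x / y + y / x)).
      by field; rewrite nzx nzy oner_eq0.
    by rewrite exy subrr mulr0.
  rewrite mulf_eq0 !subr_eq0 !sqr_eq1_inv //.
  by case/orP=> /eqP; [left | right].
case: e1 => // ->; case: e2 => // -> e; rewrite /inv2 /=.
- by left.
- by case: (swap s t) => // ei; [right; rewrite ei | left; rewrite ei].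
- case: (swap s t) => [||| ei | ei] //; last by right; rewrite ei.
    by rewrite e !invrK; ring.
  by left; rewrite ei.
- by right.
Qed.

(** These are the fixed points of [inv2] among pairs of nonzero elements; they correspond to
    proportional linear factors. *)
Definition sgn2 : {set K * K} := [set p | (p.1 ^+ 2 == 1) && (p.2 ^+ 2 == 1)].

Lemma sqr1_neq0 s : s ^+ 2 == 1 -> s != 0.
Proof. by apply: contraTneq => ->; rewrite expr0n eq_sym oner_eq0. Qed.

Lemma card_sgn2 : #|sgn2| = if 2%:R == 0 :> K then 1%N else 4%N.
Proof.
have -> : sgn2 = setX [set 1; -1] [set 1; -1].
  by apply/setP=> p; rewrite !inE !sqrf_eq1.
rewrite cardsX cards2; have -> : (1 != -1 :> K) = (2%:R != 0 :> K).
  by rewrite -subr_eq0 opprK.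
by case: eqP.
Qed.

Lemma card_recip_sgn2 : #|recip (K:=K) @: sgn2| = #|sgn2|.
Proof.
apply: card_in_imset => p p'; rewrite !inE => /andP[s1 t1] /andP[s1' t1'] /recip_inj.
case; rewrite ?sqr1_neq0 // => ->; rewrite // /inv2.
have := t1; have := s1; rewrite !sqr_eq1_inv ?sqr1_neq0 // => /eqP-> /eqP->.
by case: (p).
Qed.

(** Outside [sgn2] the fibres of [recip] are the two-element sets consisting of [p] and [inv2 p].
    The set [G] stands for the nonzero elements of [F] in the real case and for the norm-one
    elements of [E] in the imaginary case. *)
Lemma card_recip_pairs (G : {set K}) : 0 \notin G ->
    (forall s, s \in G -> s^-1 \in G) -> (forall s, s ^+ 2 = 1 -> s \in G) ->
  (#|recip (K:=K) @: (setX G G :\: sgn2)| * 2)%N = (#|G| ^ 2 - #|sgn2|)%N.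
Proof.
move=> G0 GV G1.
have nzG s : s \in G -> s != 0 by apply: contraTneq => ->.
have <- : #|setX G G :\: sgn2| = (#|G| ^ 2 - #|sgn2|)%N.
  rewrite cardsD cardsX mulnn; congr (_ - #|pred_of_set _|)%N; apply/setIidPr.
  by apply/subsetP=> p; rewrite !inE => /andP[/eqP /G1-> /eqP /G1->].
apply: card_imset_fiber => p pX.
move: (pX); rewrite !inE => /andP[nsg /andP[/nzG nz1 /nzG nz2]].
have inv_p : inv2 p != p.
  apply: contra nsg => /eqP e.
  by rewrite !sqr_eq1_inv // -{2}e -{4}e !eqxx.
have -> : [set y in setX G G :\: sgn2 | recip y == recip p] = [set p; inv2 p].
  apply/setP=> y; rewrite in_set in_set2; apply/andP/orP => [[yX /eqP/esym] | ].
    move: yX; rewrite !inE => /andP[_ /andP[/nzG nzy1 /nzG nzy2]] /recip_inj.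
    by case=> // ->; [left | right].
  case=> /eqP ->; first by rewrite pX.
  rewrite recip_inv2 eqxx !inE /= !GV //; last 2 first.
  - by move: pX; rewrite !inE => /andP[_ /andP[]].
  - by move: pX; rewrite !inE => /andP[_ /andP[]].
  by move: nsg; rewrite !sqr_eq1_inv ?invr_eq0 // !invrK ![_^-1 == _]eq_sym => ->.
by rewrite cards2 eq_sym inv_p.
Qed.

(** The hypothesis forces [v_i = x / u_i], so the entries of the product depend only on [x] and the
    ratios of the [u_i]. *)
Lemma recip_prod u v x : x != 0 -> (forall i, u 0 i * v 0 i = x) ->
  fold (u^T *m v) = x *: std_form 1 (recip (u 0 1 / u 0 0, u 0 2 / u 0 0)).
Proof.
move=> nzx uv.
have nzu i : u 0 i != 0 by apply: contraNneq nzx => u0; rewrite -(uv i) u0 mul0r.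
have vE i : v 0 i = x / u 0 i by rewrite -(uv i) mulrAC mulfV ?mul1r.
apply/matrixP; elim/ord3P; elim/ord3P; 
  rewrite !mxE !big_ord1 !mxE /= ?mulr0 ?mulr1 ?uv //.
all: rewrite !vE; field; by rewrite ?nzu.
Qed.

(** Since [v_i = x / u_i], a relation [u = c v] says that [u_i^2 = c x] for every [i], that is, that
    the ratios of the [u_i] square to 1. *)
Lemma nonproportional_recip u v x : x != 0 -> (forall i, u 0 i * v 0 i = x) ->
  nonproportional u v = ((u 0 1 / u 0 0, u 0 2 / u 0 0) \notin sgn2).
Proof.
move=> nzx uv.
have nzu i : u 0 i != 0 by apply: contraNneq nzx => u0; rewrite -(uv i) u0 mul0r.
have vE i : v 0 i = x / u 0 i by rewrite -(uv i) mulrAC mulfV ?mul1r.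
rewrite /nonproportional -negb_or inE /=; congr (~~ _).
have prop (c : K) : c != 0 -> u = c *: v ->
    ((u 0 1 / u 0 0) ^+ 2 == 1) && ((u 0 2 / u 0 0) ^+ 2 == 1).
  move=> nzc uE.
  have sq i : u 0 i ^+ 2 = c * x.
    by rewrite expr2 {1}uE mxE -(uv i); ring.
  by rewrite !expr_div_n !sq divff ?mulf_neq0 // eqxx.
apply/orP/andP => [[] /sub_rVP[c cE] | [/eqP e1 /eqP e2]].
- apply/andP; apply: (prop c) => //; apply: contraNneq (nzu 0) => c0.
  by rewrite cE c0 scale0r mxE.
- have nzc : c != 0.
    by apply: contraNneq nzx => c0; rewrite -(uv 0) cE c0 scale0r mxE mulr0.
  by apply/andP; apply: (prop c^-1); rewrite ?invr_eq0 // cE scalerA mulVf ?scale1r.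
(* The scalar is forced by the coordinate 0: [u_0^2 = c x]. *)
left; apply/sub_rVP; exists (u 0 0 ^+ 2 / x); apply/rowP.
have sq i : (u 0 i / u 0 0) ^+ 2 = 1 -> u 0 i ^+ 2 = u 0 0 ^+ 2.
  by rewrite expr_div_n => /(canRL (divfK _))->; rewrite ?mul1r ?expf_neq0.
by elim/ord3P; rewrite mxE vE; [| rewrite -(sq _ e1) | rewrite -(sq _ e2)]; field;
  rewrite nzx nzu.
Qed.

End Reciprocal.

(** * Finite fields and the singular conics *)

Lemma finField_card_pow (F : finFieldType) p : p \in [pchar F] ->
  exists n, #|F| = (p ^ n)%N.
Proof. by move=> pF; eexists; apply: (card_pprimeChar pF). Qed.

Lemma odd_card_finField (F : finFieldType) : odd #|F| = (2%:R != 0 :> F).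
Proof.
have [p p_pr pF] := finPcharP F; have [n cardF] := finField_card_pow pF.
have n_gt0 : (0 < n)%N.
  by rewrite lt0n; apply: contraTneq (finNzRing_gt1 F) => n0; rewrite cardF n0.
rewrite -(dvdn_pcharf pF) cardF oddX -leqn0 leqNgt n_gt0 /=.
case: (even_prime p_pr) => [-> // | odd_p]; rewrite odd_p.
apply/esym; apply: contraL odd_p => /(dvdn_leq (ltn0Sn 1)).
by case: p p_pr {pF cardF} => [|[|[|]]].
Qed.

Section Quadratic.
Variables (F E : finFieldType) (iota : {rmorphism F -> E}).
Let q := #|F|.

Lemma frobD (x y : E) : (x + y) ^+ q = x ^+ q + y ^+ q.
Proof.
have [p p_pr pF] := finPcharP F; have [n cardF] := finField_card_pow pF.
apply: exprDn_pchar; rewrite /q cardF pnatX pnatE //.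
by rewrite (rmorph_pchar iota pF).
Qed.

Lemma frob_iota (x : F) : iota x ^+ q = iota x.
Proof. by rewrite -rmorphXn expf_card. Qed.

(** Over [F], the polynomial [X^q - X] is the product of all [X - a]. Its image over [E] therefore
    has only roots of the form [iota a]. *)
Lemma frob_fixed (x : E) : x ^+ q = x -> exists a, x = iota a.
Proof.
move=> fix_x; have := congr1 (fun p => (map_poly iota p).[x]) (finField_genPoly F).
rewrite rmorphB /= map_polyXn map_polyX hornerE !hornerE fix_x subrr rmorph_prod.
rewrite horner_prod => /esym/eqP; rewrite prodf_seq_eq0 => /hasP[a _].
rewrite rmorphB /= map_polyX map_polyC !hornerE subr_eq0 => /eqP ->; by exists a.
Qed.

(** The nonzero elements of [E] form a cyclic group of order [(q + 1)(q - 1)]. If [z] generates it,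
    then [z^(q - 1)] is a primitive root of unity of order [q + 1], whose powers are the elements
    sought. *)
Lemma card_norm1 : #|E| = (q ^ 2)%N -> #|[set x : E | x ^+ q.+1 == 1]| = q.+1.
Proof.
move=> oE; have q_gt1 : (1 < q)%N := finNzRing_gt1 F.
pose n := (q.+1 * q.-1)%N.
have nE : n.+1 = (q ^ 2)%N by rewrite /n; move: (q) q_gt1 => [|[|k]] //; lia.
have n_gt0 : (0 < n)%N by rewrite /n muln_gt0 -subn1 subn_gt0 q_gt1.
have /hasP[z _ prim_z] : has n.-primitive_root (enum [pred x : E | x != 0]).
  apply: has_prim_root => //; last 2 first.
  - exact: enum_uniq.
  - by rewrite -cardE (cardC1 (0 : E)) oE -nE.
  apply/allP=> x; rewrite mem_enum inE unity_rootE => nzx.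
  by rewrite -(inj_eq (mulfI nzx)) mulr1 -exprS nE -oE expf_card.
have prim_w := dvdn_prim_root prim_z (dvdn_mulr q.-1 (dvdnn q.+1)).
set w := z ^+ _ in prim_w.
rewrite -[RHS]card_ord -(@card_imset _ _ (fun i : 'I_q.+1 => w ^+ i)) => [|i j /eqP].
  apply: eq_card => x; rewrite inE.
  apply/eqP/imsetP => [/(prim_rootP prim_w)[i ->] | [i _ ->]].
    by exists i.
  by rewrite exprAC (prim_expr_order prim_w) expr1n.
by rewrite (eq_prim_root_expr prim_w) !modn_small // => /eqP/val_inj.
Qed.

End Quadratic.

(** * Points of the cubic surface of singular forms *)

Section Cubic.
Variable F : finFieldType.
Let q := #|F|.
Implicit Types m n t x : F.

(** This is the tangent cone of the cubic at its double point [(2, 2, 2)], in the directions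
    [(1, m, n)]. *)
Let R m n : F := (m - n) ^+ 2 - 2%:R * (m + n) + 1.

(* The part of the conic [R = 0] off the axes is parametrized by
   [(t^2, (1 + t)^2)] with [t] different from [0] and [-1]. *)
Lemma card_conic :
  #|[set p : F * F | (p.1 != 0) && (p.2 != 0) && (R p.1 p.2 == 0)]| = (q - 2)%N.
Proof.
have <- : #|~: [set 0; -1 : F]| = (q - 2)%N.
  have := cardsC [set 0; -1 : F]; rewrite cards2 eq_sym oppr_eq0 oner_eq0 /q => <-.
  by rewrite addKn.
have char2 : 2%:R = 0 :> F -> forall x y : F, x + y = x - y.
  move=> e2 x y; apply/eqP; rewrite -subr_eq0; apply/eqP.
  have -> : x + y - (x - y) = 2%:R * y by ring.
  by rewrite e2 mul0r.
have sqrI : 2%:R = 0 :> F -> injective (fun t => t ^+ 2).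
  move=> e2 t s /= /eqP.
  rewrite -subr_eq0 subr_sqr (char2 e2 t s) mulf_eq0 orbb subr_eq0.
  by move/eqP.
rewrite -(@card_in_imset _ _ (fun t => (t ^+ 2, (1 + t) ^+ 2)));
    last first=> [t s _ _ [e1 e2]|].
  (* Squaring is injective in characteristic 2; otherwise [t] is recovered from
     [(1 + t)^2 - t^2 = 1 + 2t]. *)
  have [c2 | nz2] := eqVneq (2%:R : F) 0; first exact: sqrI.
  apply: (mulfI nz2); apply: (addrI (1 + t ^+ 2)).
  by transitivity ((1 + t) ^+ 2); [ring | rewrite e2 e1; ring].
apply: eq_card => -[m n]; rewrite !inE /=.
apply/andP/imsetP => [[/andP[nzm nzn] /eqP R0] | [t]]; last first.
  rewrite !inE negb_or => /andP[nz0 nz1] [-> ->].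
  rewrite !expf_neq0 //; last by rewrite addrC -[1]opprK subr_eq0.
  by split=> //; apply/eqP; rewrite /R; ring.
suff [t tm tn] : exists2 t, m = t ^+ 2 & n = (1 + t) ^+ 2.
  exists t; last by rewrite -tm -tn.
  rewrite !inE negb_or; apply/andP; split.
    by apply: contraNneq nzm => t0; rewrite tm t0 expr0n.
  by apply: contraNneq nzn => t1; rewrite tn t1 subrr expr0n.
(* The equation [R m n = 0] is equivalent to [(n - 1 - m)^2 = 4m]. This suggests
   [t = (n - 1 - m) / 2] in odd characteristic; in characteristic 2 it gives [n = 1 + m], and [t] is
   the square root of [m]. *)
have e : (n - 1 - m) ^+ 2 = 2%:R ^+ 2 * m.
  by apply/eqP; rewrite -subr_eq0 -R0 /R; apply/eqP; ring.
have [c2 | nz2] := eqVneq (2%:R : F) 0.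
  have [g _ gK] := injF_bij (sqrI c2).
  exists (g m); rewrite ?gK //.
  have -> : (1 + g m) ^+ 2 = 1 + 2%:R * g m + g m ^+ 2 by ring.
  rewrite gK c2 mul0r addr0; apply/eqP; rewrite -subr_eq0 opprD addrA -sqrf_eq0.
  by rewrite e c2 expr0n mul0r.
have tm : ((n - 1 - m) / 2%:R) ^+ 2 = m.
  by rewrite expr_div_n e mulrAC mulfV ?mul1r ?expf_neq0.
exists ((n - 1 - m) / 2%:R); rewrite // sqrrD tm; field.
exact: nz2.
Qed.

Lemma disc_std0 w : disc (std_form (0 : F) w) = w.1.1 * w.1.2 * w.2.
Proof. rewrite /disc !mxE /=; ring. Qed.

(** The factor [x ^+ 2] reflects the double point; the other factor is linear in [x], which makes
    the projection effective for counting. *)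
Lemma disc_std1 x m n :
  disc (std_form 1 (2%:R + x, 2%:R + x * m, 2%:R + x * n)) =
    x ^+ 2 * (x * m * n - R m n).
Proof. rewrite /disc !mxE /= /R; ring. Qed.

Lemma card_sing0 : #|[set w : F * F * F | disc (std_form 0 w) != 0]| = (q.-1 ^ 3)%N.
Proof.
have -> : [set w : F * F * F | disc (std_form 0 w) != 0] =
    setX (setX [set x | x != 0] [set x | x != 0]) [set x | x != 0].
  by apply/setP=> w; rewrite !inE disc_std0 !mulf_eq0 !negb_or.
by rewrite !cardsX card_nonzero !expnS muln1 mulnA.
Qed.

(** The total is [q + 2(q - 1) + ((q - 1)^2 - (q - 2))]: the points with [b = 2], then those with
    [mn = 0], then those with [mn] nonzero. *)
Lemma card_sing1 : #|[set w : F * F * F | disc (std_form 1 w) == 0]| = (q ^ 2).+1.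
Proof.
have q_gt1 : (1 < q)%N := finNzRing_gt1 F.
set Z := [set w | _]; rewrite -(cardsID [set w | w.1.1 == 2%:R] Z).
(* For [b = 2] the equation becomes [(c - d)^2 = 0]. *)
have -> : #|Z :&: [set w | w.1.1 == 2%:R]| = q.
  rewrite -[RHS](cardsT F).
  rewrite -[RHS](@card_imset _ _ (fun y : F => (2%:R : F, y, y))) => [|x y [] //].
  apply: eq_card => -[[b c] d]; rewrite !inE /=.
  apply/andP/imsetP => [[/eqP dz /eqP e] | [y _ [-> -> ->]]].
    exists c; rewrite // e; congr (_, _, _); apply/eqP; rewrite -subr_eq0 -sqrf_eq0.
    by rewrite -oppr_eq0 -dz e /disc !mxE /=; apply/eqP; ring.
  by rewrite eqxx /disc !mxE /=; split=> //; apply/eqP; ring.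
(* Write [b = 2 + x]; for [x != 0], the point lies on the line through the double
   point [(2, 2, 2)] with direction [(1, m, n)], and [x] is determined by [(m, n)]
   when [m n != 0]. *)
pose B := [set p : F * (F * F) | (p.1 != 0) && (p.1 * p.2.1 * p.2.2 == R p.2.1 p.2.2)].
have -> : #|Z :\: [set w | w.1.1 == 2%:R]| = #|B|.
  rewrite -(@card_in_imset _ _ (fun p : F * (F * F) =>
      (2%:R + p.1, 2%:R + p.1 * p.2.1, 2%:R + p.1 * p.2.2))); last first.
    move=> [x [m n]] [x' [m' n']]; rewrite !inE /= => /andP[nzx _] /andP[nzx' _].
    by case=> /addrI <- /addrI/(mulfI nzx) <- /addrI/(mulfI nzx) <-.
  apply: eq_card => -[[b c] d]; rewrite !inE /=.
  apply/andP/imsetP => [[b2 dz] | [[x [m n]]]].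
    have nz : b - 2%:R != 0 by rewrite subr_eq0.
    have wE : (b, c, d) = (2%:R + (b - 2%:R),
        2%:R + (b - 2%:R) * ((c - 2%:R) / (b - 2%:R)),
        2%:R + (b - 2%:R) * ((d - 2%:R) / (b - 2%:R))).
      by rewrite ![(b - 2%:R) * _]mulrC !divfK // ![2%:R + _]addrC !subrK.
    exists (b - 2%:R, ((c - 2%:R) / (b - 2%:R), (d - 2%:R) / (b - 2%:R))) => //.
    rewrite inE /=.
    by move: dz; rewrite wE disc_std1 mulf_eq0 expf_eq0 (negPf nz) /= subr_eq0.
  rewrite inE /= => /andP[nzx /eqP e] [-> -> ->].
  by rewrite disc_std1 e subrr mulr0 eqxx -[X in _ != X]addr0 (inj_eq (addrI _)).
rewrite -(cardsID [set p | p.2.1 * p.2.2 == 0] B).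
(* If [mn = 0], the equation is [R m n = 0], free of [x]. On the axes [R] is [(n - 1)^2] or
   [(m - 1)^2], so only the directions [(0, 1)] and [(1, 0)] occur, each with every nonzero [x]. *)
have -> : #|B :&: [set p | p.2.1 * p.2.2 == 0]| = (q.-1 * 2)%N.
  have -> : B :&: [set p | p.2.1 * p.2.2 == 0] =
     setX [set x | x != 0] [set (0, 1); (1, 0)].
    apply/setP=> -[x [m n]]; rewrite !inE /= -andbA; congr (_ && _).
    rewrite !xpair_eqE; have [-> | nzm] := eqVneq m 0; rewrite /R.
      rewrite mulr0 !mul0r eqxx andbT [0 == 1]eq_sym oner_eq0 orbF.
      have -> : (0 - n) ^+ 2 - 2%:R * (0 + n) + 1 = (n - 1) ^+ 2 by ring.
      by rewrite eq_sym sqrf_eq0 subr_eq0.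
    rewrite mulf_eq0 (negPf nzm) /=; have [-> | nzn] := eqVneq n 0;
      rewrite ?andbF // !andbT mulr0.
    have -> : (m - 0) ^+ 2 - 2%:R * (m + 0) + 1 = (m - 1) ^+ 2 by ring.
    by rewrite eq_sym sqrf_eq0 subr_eq0.
  by rewrite cardsX card_nonzero cards2 xpair_eqE eq_sym oner_eq0.
pose M : {set F * F} := [set p | (p.1 != 0) && (p.2 != 0)].
(* If [mn] is nonzero, then [x = R m n / (mn)]; the requirement that [x] be nonzero removes the
   conic counted in [card_conic]. *)
have -> : #|B :\: [set p | p.2.1 * p.2.2 == 0]| = #|M :\: [set p | R p.1 p.2 == 0]|.
  rewrite -[RHS](@card_imset _ _ (fun p : F * F => (R p.1 p.2 / (p.1 * p.2), p)));
    last by move=> p p' [_ ->].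
  apply: eq_card => -[x [m n]]; rewrite !inE /= mulf_eq0 negb_or.
  apply/andP/imsetP => [[/andP[nzm nzn] /andP[nzx /eqP e]] | [[m' n']]].
    have RE : R m n = x * (m * n) by rewrite -e mulrA.
    exists (m, n); last by rewrite /= RE mulfK ?mulf_neq0.
    by rewrite !inE /= RE !mulf_eq0 !negb_or nzx nzm nzn.
  rewrite !inE /= => /andP[nzR /andP[nz1 nz2]] [-> -> ->].
  rewrite nz1 nz2 mulf_neq0 ?invr_eq0 ?mulf_neq0 //= -mulrA divfK ?mulf_neq0 //.
rewrite cardsD; have -> : M :&: [set p | R p.1 p.2 == 0] =
    [set p : F * F | (p.1 != 0) && (p.2 != 0) && (R p.1 p.2 == 0)].
  by apply/setP=> p; rewrite !inE.
rewrite card_conic; have -> : M = setX [set x | x != 0] [set x | x != 0].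
  by apply/setP=> p; rewrite !inE.
rewrite cardsX card_nonzero -/q; move: q_gt1; case: (q) => [|[|k]] // _; lia.
Qed.
End Cubic.

(** * Invariance of the conic types *)

Lemma linformZ (F : finFieldType) c (u : 'rV[F]_3) : linform (c *: u) = c *: linform u.
Proof. by rewrite /linform scaler_sumr; apply: eq_bigr => i _; rewrite mxE scalerA. Qed.

Lemma qform_eq_linform (F : finFieldType) (a : 'M[F]_3) (u v : 'rV[F]_3) :
  (qform a == linform u * linform v) = (utri a == fold (u^T *m v)).
Proof. by rewrite linform_mul qform_eq utri_fold. Qed.

Lemma utri_pull_prod (R : comPzRingType) (A a : 'M[R]_3) (u v : 'rV[R]_3) :
  utri a = fold (u^T *m v) -> utri (pull A a) = fold ((u *m A)^T *m (v *m A)).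
Proof.
rewrite -[X in X = _]fold_utri => ua; rewrite utri_pull /pull.
by rewrite (fold_congr A ua) trmx_mul !mulmxA.
Qed.

Lemma utri_scale_prod (F : finFieldType) (c : F) (a : 'M[F]_3) (u v : 'rV[F]_3) :
  utri a = fold (u^T *m v) -> utri (c *: a) = fold (u^T *m (c *: v)).
Proof. by move=> ua; rewrite utriZ ua -foldZ scalemxAr. Qed.

Lemma nonproportional_mul (F : finFieldType) (A : 'M[F]_3) (u v : 'rV[F]_3) :
  A \in unitmx -> nonproportional (u *m A) (v *m A) = nonproportional u v.
Proof. by move=> uA; rewrite /nonproportional !submxMfree // row_free_unit. Qed.

Lemma nonproportionalZ (F : finFieldType) (c : F) (u v : 'rV[F]_3) :
  c != 0 -> nonproportional u (c *: v) = nonproportional u v.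
Proof.
move=> nzc; rewrite /nonproportional.
by rewrite !(eqmx_scale v nzc).
Qed.

Section Invariance.
Variables (F : finFieldType) (P : pred 'M[F]_3).
Hypothesis P_utri : forall a, P (utri a) = P a.

(** One implication is enough, as it can be applied to the inverse substitution. *)
Lemma pull_invariant : (forall A a, A \in unitmx -> P a -> P (pull A a)) ->
  forall A a, A \in unitmx -> P (pull A a) = P a.
Proof.
move=> Ppull A a uA; apply/idP/idP => [Pa | /Ppull]; last exact.
by rewrite -P_utri -(pullK a uA) Ppull ?unitmx_inv.
Qed.

Lemma scale_invariant : (forall c a, c != 0 -> P a -> P (c *: a)) ->
  forall c a, c != 0 -> P (c *: a) = P a.
Proof.
move=> PZ c a nzc; apply/idP/idP => [Pa | /PZ]; last exact.
by rewrite -[a](scalerK nzc) PZ ?invr_eq0.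
Qed.
End Invariance.

Section Predicates.
Variable F : finFieldType.
Implicit Types (a A : 'M[F]_3) (u v : 'rV[F]_3) (c : F).

(** The scalar is absorbed into the second factor, so that all three reducible types take the common
    shape [fold (u^T *m v)]. *)
Lemma double_lineP a :
  reflect (exists c u, utri a = fold (u^T *m (c *: u))) (double_line a).
Proof.
have E c u : (qform a == c *: linform u ^+ 2) = (utri a == fold (u^T *m (c *: u))).
  by rewrite -qform_eq_linform linformZ -scalerAr.
apply: (iffP existsP) => [[c /existsP[u]] | [c [u /eqP ua]]].
  by rewrite E => /eqP; exists c, u.
by exists c; apply/existsP; exists u; rewrite E.
Qed.

Lemma real_pairP a :
  reflect (exists u v, nonproportional u v /\ utri a = fold (u^T *m v)) (real_pair a).
Proof.
apply: (iffP existsP) => [[u /existsP[v /andP[n]]] | [u [v [n /eqP ua]]]].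
  by rewrite qform_eq_linform => /eqP; exists u, v.
by exists u; apply/existsP; exists v; rewrite n qform_eq_linform.
Qed.

Lemma double_line_pull A a : A \in unitmx -> double_line (pull A a) = double_line a.
Proof.
apply: (pull_invariant (P := double_line (F:=F))) => {}a.
  by rewrite /double_line qform_utri.
move=> b uA /double_lineP[c [u ub]]; apply/double_lineP.
by exists c, (u *m a); rewrite (utri_pull_prod _ ub) scalemxAl.
Qed.

Lemma double_lineZ c a : c != 0 -> double_line (c *: a) = double_line a.
Proof.
apply: (scale_invariant (P := double_line (F:=F))) => {}c {}a _ /double_lineP[d [u ua]].
by apply/double_lineP; exists (c * d), u; rewrite (utri_scale_prod c ua) scalerA.
Qed.

Lemma real_pair_pull A a : A \in unitmx -> real_pair (pull A a) = real_pair a.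
Proof.
apply: (pull_invariant (P := real_pair (F:=F))) => {}a.
  by rewrite /real_pair qform_utri.
move=> b uA /real_pairP[u [v [n ub]]]; apply/real_pairP.
by exists (u *m a), (v *m a); rewrite (utri_pull_prod _ ub) nonproportional_mul.
Qed.

Lemma real_pairZ c a : c != 0 -> real_pair (c *: a) = real_pair a.
Proof.
apply: (scale_invariant (P := real_pair (F:=F))) => {}c {}a nzc.
move=> /real_pairP[u [v [n ua]]].
apply/real_pairP; exists u, (c *: v).
by rewrite (utri_scale_prod c ua) nonproportionalZ.
Qed.

Lemma nonsingular_conic_pull A a : A \in unitmx ->
  nonsingular_conic (pull A a) = nonsingular_conic a.
Proof.
have nsE b : nonsingular_conic b = (disc b != 0) by [].
have ns_utri b : nonsingular_conic (utri b) = nonsingular_conic b.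
  by rewrite !nsE /disc !mxE.
have decr B b : nonsingular_conic (pull B b) -> nonsingular_conic b.
  have [d dE] := disc_congr B; rewrite !nsE /pull dE.
  by apply: contraNneq => ->; rewrite mulr0.
move=> uA; apply/idP/idP; first exact: decr.
by rewrite -ns_utri -(pullK a uA); apply: decr.
Qed.

Lemma nonsingular_conicZ c a : c != 0 ->
  nonsingular_conic (c *: a) = nonsingular_conic a.
Proof.
move=> nzc; have discZ : disc (c *: a) = c ^+ 3 * disc a by rewrite /disc !mxE; ring.
by rewrite [LHS](_ : _ = (disc (c *: a) != 0)) // discZ mulf_eq0 expf_eq0 (negPf nzc).
Qed.

End Predicates.

Section Imaginary.
Variables (F E : finFieldType) (iota : {rmorphism F -> E}).
Implicit Types (a A : 'M[F]_3) (u : 'rV[E]_3) (c : F).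
Notation conj := (conj_row #|F|).

Lemma imaginary_pairP a :
  reflect (exists c u, nonproportional u (conj u) /\
             utri (map_mx iota a) = fold (u^T *m (iota c *: conj u)))
          (imaginary_pair iota a).
Proof.
have E' c u : (map_mpoly iota (qform a) == iota c *: (linform u * linform (conj u))) =
    (utri (map_mx iota a) == fold (u^T *m (iota c *: conj u))).
  by rewrite -qform_eq_linform linformZ -scalerAr qform_map.
apply: (iffP existsP) => [[c /existsP[u /andP[n]]] | [c [u [n /eqP ua]]]].
  by rewrite E' => /eqP; exists c, u.
by exists c; apply/existsP; exists u; rewrite n E'.
Qed.

(** Conjugation is additive and multiplicative and fixes the entries coming from [F]. *)
Lemma conj_row_mul u A : conj (u *m map_mx iota A) = conj u *m map_mx iota A.
Proof.
apply/rowP=> j; rewrite !mxE big_ord3 !(frobD iota) big_ord3 !mxE !exprMn.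
by rewrite !(frob_iota iota).
Qed.

Lemma map_pull A a : map_mx iota (pull A a) = pull (map_mx iota A) (map_mx iota a).
Proof.
have map_utri b : map_mx iota (utri b) = utri (map_mx iota b).
  by apply/matrixP=> i j; rewrite !mxE; case: ifP; rewrite ?rmorph0.
have map_fold b : map_mx iota (fold b) = fold (map_mx iota b).
  apply/matrixP=> i j; rewrite !mxE; case: ifP => // _.
  by case: ifP; rewrite ?rmorph0 ?rmorphD.
by rewrite /pull map_fold !map_mxM map_utri map_trmx.
Qed.

Lemma imaginary_pair_pull A a : A \in unitmx ->
  imaginary_pair iota (pull A a) = imaginary_pair iota a.
Proof.
apply: (pull_invariant (P := imaginary_pair iota)) => {}a.
  by rewrite /imaginary_pair qform_utri.
move=> b uA /imaginary_pairP[c [u [n ub]]]; apply/imaginary_pairP.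
exists c, (u *m map_mx iota a); rewrite conj_row_mul nonproportional_mul ?map_unitmx //.
by rewrite map_pull (utri_pull_prod _ ub) scalemxAl.
Qed.

Lemma imaginary_pairZ c a : c != 0 ->
  imaginary_pair iota (c *: a) = imaginary_pair iota a.
Proof.
apply: (scale_invariant (P := imaginary_pair iota)) => {}c {}a _.
move=> /imaginary_pairP[d [u [n ua]]].
apply/imaginary_pairP; exists (c * d), u.
by rewrite map_mxZ (utri_scale_prod _ ua) scalerA rmorphM.
Qed.

End Imaginary.

(** * The four counts *)

Lemma std_prod (R : comPzRingType) (x : R) w (u v : 'rV[R]_3) :
  std_form x w = fold (u^T *m v) -> forall i, u 0 i * v 0 i = x.
Proof.
move=> e; elim/ord3P.
- by have /matrixP/(_ 0 0) := e; rewrite !mxE big_ord1 !mxE.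
- by have /matrixP/(_ 1 1) := e; rewrite !mxE big_ord1 !mxE.
- by have /matrixP/(_ 2 2) := e; rewrite !mxE big_ord1 !mxE.
Qed.

Lemma prod_neq0 (R : pzRingType) w (u v : 'rV[R]_3) :
  w != 0 -> std_form 0 w = fold (u^T *m v) -> (u != 0) && (v != 0).
Proof.
have fold0 : fold (0 : 'M[R]_3) = 0.
  by apply/matrixP=> i j; rewrite !mxE addr0 !if_same.
move=> nzw e; rewrite -negb_or; apply: contra nzw => /orP uv0; apply/eqP.
suff : std_form 0 w = std_form (0 : R) 0 by case/std_inj.
by rewrite std0 e; case: uv0 => /eqP->; rewrite ?trmx0 ?mul0mx ?mulmx0 fold0.
Qed.

Section Rows.
Variable K : finFieldType.

Definition row1 (s t : K) : 'rV[K]_3 := \row_(i < 3) [:: 1; s; t]`_i.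

(** Here [u_i v_i = 1] for every [i], so dividing [u] by [u_0] and multiplying [v] by it leaves the
    product unchanged and normalizes both first coordinates to 1. *)
Lemma std1_recip w (u v : 'rV[K]_3) : std_form 1 w = fold (u^T *m v) ->
  exists2 p, w = recip p &
    [/\ p = (u 0 1 / u 0 0, u 0 2 / u 0 0), p.1 != 0, p.2 != 0 &
        nonproportional u v = (p \notin sgn2 K)].
Proof.
move=> e; have uv := std_prod e.
have nzu i : u 0 i != 0.
  by apply: contraTneq (oner_neq0 K) => u0; rewrite -(uv i) u0 mul0r eqxx.
exists (u 0 1 / u 0 0, u 0 2 / u 0 0).
  by move: e; rewrite (recip_prod (oner_neq0 K) uv) scale1r => /std_inj[].
by rewrite (nonproportional_recip (oner_neq0 K) uv) !mulf_neq0 ?invr_eq0.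
Qed.

Lemma recip_std1 s t : s != 0 -> t != 0 ->
  std_form 1 (recip (s, t)) = fold ((row1 s t)^T *m row1 s^-1 t^-1) /\
  nonproportional (row1 s t) (row1 s^-1 t^-1) = ((s, t) \notin sgn2 K).
Proof.
move=> nzs nzt.
have uv i : row1 s t 0 i * row1 s^-1 t^-1 0 i = 1.
  by elim/ord3P: i; rewrite !mxE /= ?mulfV ?mulr1.
rewrite (recip_prod (oner_neq0 K) uv) (nonproportional_recip (oner_neq0 K) uv).
by rewrite !mxE /= !divr1 scale1r.
Qed.

End Rows.

Section Counts.
Variables (F E : finFieldType) (iota : {rmorphism F -> E}).
Let q := #|F|.
Implicit Types (w : F * F * F).

(** A zero diagonal means [c u_i^2 = 0] for every [i], which would make the form vanish. *)
Lemma double_line_std0 w : w != 0 -> double_line (std_form 0 w) = false.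
Proof.
move=> nzw; apply/double_lineP => -[c [u]]; rewrite utri_std => e.
have /andP[nzu nzcu] := prod_neq0 nzw e; have uv := std_prod e.
have nzc : c != 0 by apply: contraNneq nzcu => ->; rewrite scale0r.
case/eqP: nzu; apply/rowP=> i; rewrite !mxE; apply/eqP; move/eqP: (uv i).
by rewrite mxE !mulf_eq0 (negPf nzc) /= orbb.
Qed.

Lemma double_line_std1 :
  [set w | double_line (std_form 1 w)] = recip (K:=F) @: sgn2 F.
Proof.
apply/setP=> w; rewrite inE; apply/double_lineP/imsetP => [[c [u]] | [[s t] st1 ->]].
  rewrite utri_std => /std1_recip[p -> [_ _ _ np]]; exists p => //.
  by rewrite -[_ \in _]negbK -np /nonproportional negb_and !negbK scalemx_sub ?orbT.
have /= := st1; rewrite inE /= => /andP[s1 t1].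
have [nzs nzt] := (sqr1_neq0 s1, sqr1_neq0 t1).
have [e _] := recip_std1 nzs nzt.
exists 1, (row1 s t); rewrite utri_std e scale1r.
by move: s1 t1; rewrite !sqr_eq1_inv // => /eqP-> /eqP->.
Qed.

(** The discriminant of a product vanishes identically. Conversely, it equals [bcd] here, and when
    one of these coefficients is zero a variable factors out. *)
Lemma real_pair_std0 w : w != 0 ->
  real_pair (std_form 0 w) = (disc (std_form 0 w) == 0).
Proof.
move=> nzw; apply/real_pairP/eqP => [[u [v [_]]] | ].
  by rewrite utri_std => ->; rewrite /disc !mxE !big_ord1 !mxE /=; ring.
rewrite disc_std0; case: w nzw => [[b c] d] nzw /= /eqP.
pose e i : 'rV[F]_3 := delta_mx 0 i.
have nprop (i : 'I_3) (x y : F) (j k : 'I_3) : i != j -> i != k -> j != k ->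
    (x != 0) || (y != 0) ->
    nonproportional (e i) (x *: e j + y *: e k).
  move=> ij ik jk xy; have ji : j != i by rewrite eq_sym.
  have ki : k != i by rewrite eq_sym.
  have kj : k != j by rewrite eq_sym.
  rewrite /nonproportional; apply/andP; split; apply/negP => /sub_rVP[z /rowP zE].
    have := zE i; rewrite !mxE !eqxx (negPf ij) (negPf ik) /= !mulr0 addr0 mulr0.
    by move/eqP; rewrite oner_eq0.
  have := (zE j, zE k); rewrite !mxE !eqxx (negPf ji) (negPf ki) (negPf kj) (negPf jk) /=.
  rewrite !mulr1 !mulr0 addr0 add0r => -[x0 y0].
  by move: xy; rewrite x0 y0 eqxx.
have nz (x y : F) : ~~ ((x == 0) && (y == 0)) -> (x != 0) || (y != 0).
  by rewrite negb_and.
rewrite !mulf_eq0 -orbA => /or3P[] /eqP z0; subst.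
(* For [b = 0] the form is [Z (cX + dY)]; the two other cases are analogous, with [Y] and [X] as the
   common factor. *)
- exists (e 2), (c *: e 0 + d *: e 1); split.
    by apply: nprop => //; apply: nz; apply: contra nzw => /andP[/eqP-> /eqP->].
  rewrite utri_std; apply/matrixP.
  elim/ord3P; elim/ord3P; rewrite !mxE ?big_ord1 ?mxE /=; ring.
- exists (e 1), (b *: e 0 + d *: e 2); split.
    by apply: nprop => //; apply: nz; apply: contra nzw => /andP[/eqP-> /eqP->].
  rewrite utri_std; apply/matrixP.
  elim/ord3P; elim/ord3P; rewrite !mxE ?big_ord1 ?mxE /=; ring.
- exists (e 0), (b *: e 1 + c *: e 2); split.
    by apply: nprop => //; apply: nz; apply: contra nzw => /andP[/eqP-> /eqP->].
  rewrite utri_std; apply/matrixP.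
  elim/ord3P; elim/ord3P; rewrite !mxE ?big_ord1 ?mxE /=; ring.
Qed.

Lemma real_pair_std1 : [set w | real_pair (std_form 1 w)] =
  recip (K:=F) @: (setX [set x | x != 0] [set x | x != 0] :\: sgn2 F).
Proof.
apply/setP=> w; rewrite inE; apply/real_pairP/imsetP => [[u [v [n]]] | [[s t]]].
  rewrite utri_std => /std1_recip[p -> [_ nz1 nz2 np]]; exists p => //.
  by rewrite in_setD -np n !inE nz1 nz2.
rewrite in_setD => /andP[n]; rewrite !inE /= => /andP[nzs nzt] ->.
have [e np] := recip_std1 nzs nzt.
by exists (row1 s t), (row1 s^-1 t^-1); rewrite np n utri_std.
Qed.

Let iota3 w : E * E * E := (iota w.1.1, iota w.1.2, iota w.2).

Lemma map_std x w : map_mx iota (std_form x w) = std_form (iota x) (iota3 w).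
Proof. by apply/matrixP; elim/ord3P; elim/ord3P; rewrite !mxE /= ?rmorph0. Qed.

Lemma iota3_inj : injective iota3.
Proof. by move=> [[? ?] ?] [[? ?] ?] [/fmorph_inj-> /fmorph_inj-> /fmorph_inj->]. Qed.

(** The diagonal coefficients are [c] times the norms of the [u_i], and a norm vanishes only at
    0. *)
Lemma imaginary_pair_std0 w : w != 0 -> imaginary_pair iota (std_form 0 w) = false.
Proof.
move=> nzw; apply/imaginary_pairP => -[c [u [_]]].
rewrite map_std utri_std rmorph0 => e.
have nziw : iota3 w != 0.
  by apply: contraNneq nzw => w0; apply/eqP/iota3_inj; rewrite w0 /iota3 !rmorph0.
have /andP[nzu nzcu] := prod_neq0 nziw e; have uv := std_prod e.
have nzc : iota c != 0 by apply: contraNneq nzcu => ->; rewrite scale0r.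
case/eqP: nzu; apply/rowP=> i; rewrite !mxE; apply/eqP; move/eqP: (uv i).
by rewrite !mxE !mulf_eq0 (negPf nzc) expf_eq0 /=; case/orP=> // /andP[].
Qed.

(** All [u_i] have the same norm [1/c], so their ratios have norm 1. Conversely, conjugation inverts
    elements of norm 1, so the conjugate of [X + sY + tZ] is [X + Y/s + Z/t]. The sets are compared
    over [E], where [s] and [t] live. *)
Lemma imaginary_pair_std1 : iota3 @: [set w | imaginary_pair iota (std_form 1 w)] =
  recip (K:=E) @: (setX [set x | x ^+ q.+1 == 1] [set x | x ^+ q.+1 == 1] :\: sgn2 E).
Proof.
have q_gt0 : (0 < q)%N := ltnW (finNzRing_gt1 F).
apply/setP=> z; apply/imsetP/imsetP => [[w] | [[s t]]].
  rewrite inE => /imaginary_pairP[c [u [n]]]; rewrite map_std utri_std rmorph1 => e ->.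
  have [p -> [pE nz1 nz2 np]] := std1_recip e; exists p => //.
  have nzc : iota c != 0.
    apply: contraTneq (oner_neq0 E) => c0.
    by rewrite -(std_prod e 0) mxE c0 mul0r mulr0 eqxx.
  have norm i : u 0 i ^+ q.+1 = (iota c)^-1.
    apply: (mulfI nzc); rewrite mulfV // -(std_prod e i) !mxE exprS; ring.
  rewrite in_setD -np nonproportionalZ // n /= pE !inE /= !expr_div_n !norm.
  by rewrite divff ?invr_eq0 // !eqxx.
rewrite in_setD => /andP[n]; rewrite !inE /= => /andP[/eqP s1 /eqP t1] ->.
have nz x : x ^+ q.+1 = 1 -> x != 0 :> E.
  by move=> x1; apply: contraTneq (oner_neq0 E) => x0; rewrite -x1 x0 expr0n eqxx.
have frobV x : x ^+ q.+1 = 1 -> x ^+ q = x^-1 :> E.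
  by move=> x1; apply: (mulfI (nz x x1)); rewrite -exprS x1 mulfV ?nz.
have [nzs nzt] := (nz s s1, nz t t1).
have [e np] := recip_std1 nzs nzt.
(* Conjugation exchanges [x] and its inverse, so their sum is fixed and comes from [F]. This also
   applies to [s / t], which gives the third coefficient. *)
have fixV x : x ^+ q = x^-1 -> exists a, x + x^-1 = iota a :> E.
  by move=> xq; apply: frob_fixed; rewrite (frobD iota) exprVn -/q xq invrK addrC.
have [b bE] := fixV s (frobV s s1); have [c cE] := fixV t (frobV t t1).
have [d dE] : exists d, s / t + t / s = iota d.
  rewrite -[t / s]invf_div; apply: fixV.
  by rewrite expr_div_n !frobV // -invfM mulrC; congr _^-1; rewrite invrK mulrC.
exists (b, c, d); last by rewrite /iota3 /recip /= bE cE dE.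
rewrite inE; apply/imaginary_pairP; exists 1, (row1 s t).
have -> : conj_row #|F| (row1 s t) = row1 s^-1 t^-1.
  by apply/rowP; elim/ord3P; rewrite !mxE /= ?expr1n -/q ?frobV.
by rewrite np n rmorph1 scale1r -e map_std utri_std rmorph1 /iota3 /recip /= bE cE dE.
Qed.

Lemma card_double_line_std :
  #|[set w : F * F * F | double_line (std_form (1 : F) w)]| = #|sgn2 F|.
Proof. by rewrite double_line_std1 card_recip_sgn2. Qed.

Lemma card_real_pair_std :
  (#|[set w : F * F * F | real_pair (std_form 1%R w)]| * 2)%N = (q.-1 ^ 2 - #|sgn2 F|)%N.
Proof.
rewrite real_pair_std1 card_recip_pairs ?card_nonzero //.
- by rewrite inE eqxx.
- by move=> s; rewrite !inE invr_eq0.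
- by move=> s /eqP/sqr1_neq0; rewrite inE.
Qed.

Lemma card_imaginary_pair_std : #|E| = (q ^ 2)%N ->
  (#|[set w : F * F * F | imaginary_pair iota (std_form 1 w)]| * 2)%N = (q.+1 ^ 2 - #|sgn2 E|)%N.
Proof.
move=> cE; rewrite -(card_imset _ iota3_inj) imaginary_pair_std1 card_recip_pairs.
- by rewrite (card_norm1 cE).
- by rewrite inE expr0n eq_sym oner_eq0.
- by move=> s; rewrite !inE exprVn invr_eq1.
(* Square roots of 1 have norm 1: for odd [q] the exponent [q + 1] is even, and for even [q] one has
   [-1 = 1]. *)
- move=> s s1; rewrite inE; have [o | e] := boolP (odd q).
    by rewrite -(odd_double_half q.+1) /= o add0n -mul2n exprM s1 expr1n.
  have: 2%:R == 0 :> F by rewrite -[_ == _]negbK -odd_card_finField.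
  rewrite -(fmorph_eq0 iota) rmorph_nat => e2.
  move/eqP: s1; rewrite sqrf_eq1 => /orP[] /eqP->; first by rewrite expr1n.
  rewrite -[-1]addr0 -(eqP e2); have -> : -1 + 2%:R = 1 :> E by ring.
  by rewrite expr1n.
Qed.

Lemma card_real_pair_std0 :
  #|[set w : F * F * F | (w != 0) && real_pair (std_form 0 w)]| = (q ^ 3 - (q.-1 ^ 3).+1)%N.
Proof.
pose z : F * F * F := 0.
have -> : [set w : F * F * F | (w != 0) && real_pair (std_form 0 w)] =
    ~: (z |: [set w : F * F * F | disc (std_form 0 w) != 0]).
  apply/setP=> w; rewrite !inE negb_or negbK /z.
  by case: eqP => //= /eqP nzw; rewrite real_pair_std0.
have cardF3 : #|{: F * F * F}| = (q ^ 3)%N by rewrite !card_prod !expnS muln1 mulnA.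
by rewrite cardsCs setCK cardF3 cardsU1 card_sing0 inE disc_std0 /= !mulr0 eqxx.
Qed.

Lemma card_nonsingular_std0 :
  #|[set w : F * F * F | (w != 0) && nonsingular_conic (std_form 0 w)]| = (q.-1 ^ 3)%N.
Proof.
rewrite -card_sing0; apply: eq_card => w; rewrite !inE.
have [-> | //] := eqVneq w 0.
by rewrite disc_std0 /= mulr0 eqxx.
Qed.

Lemma card_nonsingular_std1 :
  #|[set w : F * F * F | nonsingular_conic (std_form 1 w)]| = (q ^ 3 - (q ^ 2).+1)%N.
Proof.
have cardF3 : #|{: F * F * F}| = (q ^ 3)%N by rewrite !card_prod !expnS muln1 mulnA.
rewrite -cardF3 -(card_sing1 F) cardsCs; congr (_ - _)%N.
by apply: eq_card => w; rewrite !inE negbK.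
Qed.

End Counts.

(* Assembly of the hyperplane-orbit distribution *)
Local Close Scope ring_scope.

Theorem lemma4p15 (q : nat) (F E : finFieldType) (iota : {rmorphism F -> E})
    (cardF : #|F| = q) (cardE : #|E| = q ^ 2)
    (L : {set {set 'M[F]_3}}) (hL : L \in o_14_1 F) :
  (odd q ->
     OD4 iota L = [:: 4; (q ^ 2 - 1) %/ 2 + 2 * q - 1;
                      (q ^ 2 - 1) %/ 2 + q - 1; q ^ 3 - 2 * q]) /\
  (~~ odd q ->
     OD4 iota L = [:: 1; q ^ 2 %/ 2 + 2 * q; q ^ 2 %/ 2 + q; q ^ 3 - 2 * q]).
Proof.
have q_gt1 : (1 < q)%N by rewrite -cardF finNzRing_gt1.
have count P := @count_through_vectors F P L.
have c1 := count _ (@double_line_pull F) (@double_lineZ F) hL.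
have c2 := count _ (@real_pair_pull F) (@real_pairZ F) hL.
have c3 := count _ (@imaginary_pair_pull F E iota) (@imaginary_pairZ F E iota) hL.
have c4 := count _ (@nonsingular_conic_pull F) (@nonsingular_conicZ F) hL.
rewrite card_std in c1; last exact: double_lineZ.
rewrite card_std in c2; last exact: real_pairZ.
rewrite card_std in c3; last exact: imaginary_pairZ.
rewrite card_std in c4; last exact: nonsingular_conicZ.
have zero (P : pred 'M[F]_3) : (forall w, w != 0%R -> P (std_form 0%R w) = false) ->
    #|[set w : F * F * F | ((w != 0) && P (std_form 0 w))%R]| = 0%N.
  move=> P0; apply/eqP; rewrite cards_eq0; apply/eqP/setP=> w; rewrite !inE.
  by apply/negP => /andP[/P0->].
rewrite zero ?card_double_line_std ?cardF in c1; last exact: double_line_std0.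
rewrite card_real_pair_std0 cardF in c2.
rewrite zero ?cardF in c3; last exact: imaginary_pair_std0.
rewrite card_nonsingular_std0 card_nonsingular_std1 cardF in c4.
have r2 := card_real_pair_std F; rewrite cardF in r2.
have r3 := card_imaginary_pair_std iota; rewrite cardF in r3; move/(_ cardE) in r3.
have charE : ((2%:R == 0 :> E) = (2%:R == 0 :> F))%R.
  by rewrite -(rmorph_nat iota) fmorph_eq0.
have oq := odd_card_finField F; rewrite cardF in oq.
rewrite !card_sgn2 charE in c1 r2 r3.
rewrite /OD4.
move: c1 c2 c3 c4 r2 r3.
set n1 := count_through _ _; set n2 := count_through _ _.
set n3 := count_through _ _; set n4 := count_through _ _.
set m2 := #|_|; set m3 := #|_|.
move: n1 n2 n3 n4 m2 m3 => n1 n2 n3 n4 m2 m3.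
have q_pos : (0 < q.-1)%N by rewrite -subn1 subn_gt0.
move=> c1 c2 c3 c4 r2 r3.
(* Each count was obtained multiplied by [q - 1], the number of equations of a hyperplane. *)
have cancel n x : (n * q.-1 = q.-1 * x)%N -> n = x.
  by rewrite mulnC => /eqP; rewrite eqn_pmul2l // => /eqP.
have e1 := cancel _ _ (etrans c1 (addn0 _)).
have e3 := cancel _ _ (etrans c3 (addn0 _)).
(* The forms with zero diagonal contribute [q^3 - (q - 1)^3 - 1 = 3q(q - 1)] vectors, hence [3q]
   hyperplanes. *)
have e2 : n2 = (m2 + 3 * q)%N.
  apply: cancel; rewrite c2 mulnDr; congr addn.
  case: (q) q_gt1 => // p _ /=.
  have -> : (p.+1 ^ 3 = p * (3 * p.+1) + (p ^ 3).+1)%N by ring.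
  by rewrite addnK.
(* After division by [q - 1] the count is [(q^3 - q^2 - 1) + (q - 1)^2]. *)
have e4 : n4 = (q ^ 3 - 2 * q)%N.
  apply: cancel; rewrite c4; case: (q) q_gt1 => [|[|p]] // _ /=.
  have -> : (p.+2 ^ 3 - (p.+2 ^ 2).+1 = p ^ 3 + 5 * p ^ 2 + 8 * p + 3)%N.
    by lia.
  have -> : (p.+2 ^ 3 - 2 * p.+2 = p ^ 3 + 6 * p ^ 2 + 10 * p + 4)%N by lia.
  by ring.
rewrite {}e1 {}e2 {}e3 {}e4.
split=> [odd_q | even_q].
  move: oq; rewrite odd_q => /esym/negPf nz2; rewrite nz2 in r2 r3 *.
  (* An odd [q] greater than 1 is at least 3; this substitution lets the truncated subtractions and
     the halves be evaluated. *)
  have [k qE] : exists k, q = (2 * k + 3)%N.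
    by exists (q./2.-1); have := odd_double_half q; rewrite odd_q -mul2n; lia.
  have -> : ((q ^ 2 - 1) %/ 2)%N = (2 * k ^ 2 + 6 * k + 4)%N.
    have -> : (q ^ 2 - 1)%N = ((2 * k ^ 2 + 6 * k + 4) * 2)%N.
      by rewrite qE !expnS !expn0; lia.
    by rewrite mulnK.
  rewrite qE !expnS !expn0 in r2 r3 *.
  congr [:: _; _; _; _]; lia.
move: oq; rewrite (negPf even_q) => /esym/negbFE z2; rewrite z2 in r2 r3 *.
have [k qE] : exists k, q = (2 * k + 2)%N.
  by exists (q./2.-1); have := odd_double_half q; rewrite (negPf even_q) -mul2n; lia.
have -> : (q ^ 2 %/ 2)%N = (2 * k ^ 2 + 4 * k + 2)%N.
  have -> : (q ^ 2)%N = ((2 * k ^ 2 + 4 * k + 2) * 2)%N.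
    by rewrite qE !expnS !expn0; lia.
  by rewrite mulnK.
rewrite qE !expnS !expn0 in r2 r3 *.
congr [:: _; _; _; _]; lia.
Qed.
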